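(* Let $\alpha>0$ and $\eta>0$. If $\mu\in\mathcal{M}_{\alpha}$, then $\nu=I^{+}_{\eta}\mu\in\mathcal{M}_{\alpha+\eta}$, and given $\nu$ we can recover $\mu$ from $$F_{\mu}(y)=\frac{1}{\Gamma(1+n-\eta)}\left(\frac{d}{dy}\right)^n\int_{[0,y)}\frac{\nu(du)}{(y-u)^{\eta-n}},$$ where $n=[\eta]$, and $\mu(\{\infty\})=\nu(\{\infty\})$.
   Context: For $\alpha>0$, $\mathcal{M}_{\alpha}$ denotes the set of non-negative Borel measures $\mu$ on $[0,\infty]$ (the one-point compactification of $[0,\infty)$) with $\int_{[0,\infty)}(1+t)^{-\alpha}\mu(dt)<\infty$ and $\mu(\{\infty\})<\infty$. For $\mu\in\mathcal{M}_\alpha$, $F_\mu$ is the left-continuous distribution function $F_{\mu}(x)=\mu([0,x))$, normalized by $F_\mu(0)=0$; it determines $\mu$ except for a possible atom at infinity. $[\eta]$ is the integer part of $\eta$. For $\mu\in\mathcal{M}_\alpha$ and $\eta>0$ the left-sided Riemann-Liouville fractional integral $I^{+}_{\eta}\mu$ is the measure $\nu$ on $[0,\infty]$ given by $$\nu(B)=\frac{1}{\Gamma(\eta)}\int_{B\setminus\{\infty\}}dy\int_{[0,y)}\frac{\mu(du)}{(y-u)^{1-\eta}}+\mu(B\cap\{\infty\})$$ for each Borel set $B\subset[0,\infty]$.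
   Formalization: At atoms of μ the n-th derivative (n ≥ 1) does not exist (η=1, μ=δ₁, y=1), so the formula is proved with the n-fold left derivative at every y ≥ 0, and with the ordinary n-th derivative where F_μ is continuous; functions of y are extended by 0 to y < 0. *)

(* Defs.v *)
From mathcomp Require Import all_boot all_order all_algebra.
From mathcomp Require Import all_classical all_reals all_analysis.
From mathcomp Require Import measurable_realfun.
Set Implicit Arguments.
Unset Strict Implicit.
Unset Printing Implicit Defensive.
Import Order.TTheory GRing.Theory Num.Theory.
Import numFieldNormedType.Exports.
Local Open Scope classical_set_scope.
Local Open Scope ring_scope.

Definition gamma_fun {R : realType} (s : R) : R :=
  \int[lebesgue_measure]_(x in `]0, +oo[) (x `^ (s - 1) * expR (- x)).

(* A Borel measure on [0, +oo] is a measure on \bar R, with its Borel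
   sigma-algebra, that does not charge the negative half-line. *)
Definition in_Mclass {R : realType} (alpha : R)
    (mu : {measure set (\bar R) -> \bar R}) : Prop :=
  [/\ (mu [set t | t < 0] = 0)%E,
      (\int[mu]_(t in [set t : \bar R | (0 <= t < +oo)%E])
         ((1 + fine t) `^ (- alpha))%:E < +oo)%E
    & (mu [set +oo%E] < +oo)%E].

(* Extended by 0 to y < 0, where [0, y) is empty. *)
Definition distr_fun {R : realType} (mu : set (\bar R) -> \bar R) (y : R)
    : \bar R :=
  mu [set u : \bar R | (0 <= u < y%:E)%E].

(* The integral of mu(du) / (y - u)^s over 0 <= u < y; here y - u > 0, so
   neither powR nor the inverse is ever evaluated at 0. *)
Definition RL_integral {R : realType} (s : R)
    (mu : {measure set (\bar R) -> \bar R}) (y : R) : \bar R :=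
  (\int[mu]_(u in [set u : \bar R | (0 <= u < y%:E)%E])
     ((y - fine u) `^ s)^-1%:E)%E.

(* The set function I^+_eta mu. *)
Definition frac_integral {R : realType} (eta : R)
    (mu : {measure set (\bar R) -> \bar R}) (B : set (\bar R)) : \bar R :=
  (((gamma_fun eta)^-1)%:E *
     \int[lebesgue_measure]_(y in [set y : R | (0 <= y)%R /\ B y%:E])
        RL_integral (1 - eta) mu y
   + mu (B `&` [set +oo]))%E.

(* At an atom of mu the n-th derivative in the inversion formula (n >= 1) exists
   only from the left, where it gives F_mu because F_mu is left-continuous. *)
Definition left_derivable {R : realType} (f : R -> R) (y : R) : Prop :=
  cvg (h^-1 * (f (h + y) - f y) @[h --> 0^'-]).

Definition left_derive {R : realType} (f : R -> R) (y : R) : R :=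
  lim (h^-1 * (f (h + y) - f y) @[h --> 0^'-]).

(* Main.v *)
Require Import Defs.
From HB Require Import structures.
From mathcomp Require Import all_boot all_order all_algebra.
From mathcomp Require Import all_classical all_reals all_analysis.
From mathcomp Require Import measurable_realfun.
From mathcomp Require Import ring lra.
Set Implicit Arguments.
Unset Strict Implicit.
Unset Printing Implicit Defensive.

Import Order.TTheory GRing.Theory Num.Theory.
Import numFieldNormedType.Exports.
Local Open Scope classical_set_scope.
Local Open Scope ring_scope.

(** Everything takes place on the finite part [m] of [mu], a measure on the
    real line that vanishes on the negative half-line and is finite below every
    point ([finite_part], [Mclass_finite_below]). With [tpow a x] the power
    [x `^ (a - 1)] cut off to 0 for [x <= 0], the measure [nu] has on the finite
    points the density [frac_density eta m], the convolution of [m] with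
    [tpow eta], divided by [Gamma(eta)].

    That [nu] is in the class of exponent [alpha + eta] follows from Tonelli's
    theorem: the substitution [v = (1 + u) t + u] gives
    [\int (1 + v) `^ (- (alpha + eta)) * tpow eta (v - u) dv
     = D * (1 + u) `^ (- alpha)] for [u >= 0], with a finite constant [D]
    ([integral_weight_frac_density]).

    For the inversion, truncated powers convolve as
    [tpow a * tpow b = B(a, b) tpow (a + b)], by scaling ([tpow_conv]);
    integrating this against [expR (- x)] yields
    [Gamma(a) Gamma(b) = B(a, b) Gamma(a + b)] ([eGammaM]). Taken with [a = eta]
    and [b = 1 + n - eta], so that [a + b = n + 1] is an integer, Tonelli's
    theorem turns the integral of [nu (du) / (y - u) `^ (eta - n)] into
    [Gamma(1 + n - eta)] times the [n]-fold iterated integral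
    [J_n y = \int_[0, y[ (y - u) ^+ n / n! m (du)] of the distribution function
    ([RL_integral_frac_measure], [primitive]).

    It remains to differentiate [J_n]. An elementary inequality for powers gives
    [h * J_k y <= J_(k+1) (y + h) - J_(k+1) y <= h * J_k (y + h)] for [h >= 0]
    ([primitive_increments]), so the difference quotients of [J_(k+1)] at [y] are
    within [`|J_k (y + h) - J_k y|] of [J_k y] for either sign of [h]. Hence the
    left derivative of [J_(k+1)] is [J_k] wherever [J_k] is left-continuous, and
    the derivative is [J_k] wherever [J_k] is continuous. Now [J_0], the
    distribution function, is left-continuous, and [J_k] is continuous for
    [k >= 1]. *)

(** * Measures with a density, image measures, affine substitutions *)

Section density.
Local Open Scope ereal_scope.
Context d (T : measurableType d) (R : realType).
Variables (mu : {measure set T -> \bar R}) (g : T -> \bar R).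

(** The two proofs are arguments so that the measure structure is inferred from
    the term. *)
Definition density_measure (mg : measurable_fun setT g)
  (g0 : forall x, 0 <= g x) (A : set T) : \bar R := \int[mu]_(x in A) g x.

Hypotheses (mg : measurable_fun setT g) (g0 : forall x, 0 <= g x).
Local Notation nu := (density_measure mg g0).

Let nu0 : nu set0 = 0.
Proof. by rewrite /density_measure integral_set0. Qed.

Let nu_ge0 A : 0 <= nu A.
Proof. exact: integral_ge0. Qed.

Let nu_additive : semi_sigma_additive nu.
Proof.
move=> F mF tF mUF; rewrite /density_measure; apply: cvg_toP.
  apply: ereal_nondecreasing_is_cvgn => m n mn.
  by apply: lee_sum_nneg_natr => // k _ _; exact: integral_ge0.
by rewrite ge0_integral_bigcup//; exact: measurable_funTS.
Qed.

HB.instance Definition _ := isMeasure.Build _ _ _ nu nu0 nu_ge0 nu_additive.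

Import HBNNSimple.

Let integral_density_nnsfun (h : {nnsfun T >-> R}) :
  \int[nu]_x (h x)%:E = \int[mu]_x ((h x)%:E * g x).
Proof.
under [LHS]eq_integral do rewrite fimfunE -fsumEFin//.
rewrite ge0_integral_fsum//; last 2 first.
  - by move=> r /=; apply: measurableT_comp => //; exact: measurableT_comp.
  - by move=> r t _; rewrite EFinM nnfun_muleindic_ge0.
transitivity (\sum_(r \in range h)
    \int[mu]_x ((r * \1_(h @^-1` [set r]) x)%:E * g x)); last first.
  rewrite -ge0_integral_fsum//; last 2 first.
  - move=> r; apply: emeasurable_funM => //.
    by apply/measurable_EFinP/measurable_funM => //; exact: measurable_cst.
  - by move=> r t _; rewrite mule_ge0// EFinM nnfun_muleindic_ge0.
  apply: eq_integral => t _; rewrite [in RHS]fimfunE -fsumEFin//.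
  rewrite ge0_mule_fsuml// => r; by rewrite EFinM nnfun_muleindic_ge0.
apply: eq_fsbigr => r _.
rewrite integralZl_indic_nnsfun// integral_indic//= setIT.
under eq_integral do rewrite EFinM -muleA.
have [r0|r0] := leP 0%R r; last first.
  rewrite preimage_nnfun0// [in LHS]/density_measure integral_set0 mule0.
  by rewrite integral0_eq// => x _; rewrite indicE in_set0 mul0e mule0.
rewrite ge0_integralZl//; last 2 first.
- by apply: emeasurable_funM => //; apply/measurable_EFinP.
- by move=> x _; rewrite mule_ge0// lee_fin.
congr (_ * _); rewrite /density_measure integral_mkcond.
by apply: eq_integral => x _; rewrite epatch_indic /= muleC.
Qed.

(* The factor [c] may be infinite. If [l = 0] then all [u n] vanish, if [c = 0] then
   the products do, and otherwise multiplication is continuous at [(l, c)]. *)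
Let cvg_muler (u : nat -> R) (l : \bar R) (c : \bar R) :
  (forall n, (0 <= u n)%R) -> {homo u : m n / (m <= n)%N >-> (m <= n)%R} -> 0 <= c ->
  (EFin \o u) n @[n --> \oo] --> l ->
  (u n)%:E * c @[n --> \oo] --> l * c.
Proof.
move=> u0 nu_ c0 ul.
have [l0|l0] := eqVneq l 0.
  have uz n : u n = 0%R.
    apply/eqP; rewrite eq_le u0 andbT -lee_fin -[leRHS]l0.
    rewrite -(cvg_lim _ ul)//; apply: lime_ge; first by apply/cvg_ex; exists l.
    by near=> m; rewrite lee_fin; apply: nu_; near: m; exact: nbhs_infty_ge.
  rewrite l0 mul0e; under eq_fun do rewrite uz mul0e; exact: cvg_cst.
have [->|cn0] := eqVneq c 0.
  by rewrite mule0; under eq_fun do rewrite mule0; exact: cvg_cst.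
apply: (cvgeM (g := fun=> c)) => //; last exact: cvg_cst.
by apply: neq0_mule_def; rewrite mule_neq0.
Unshelve. all: by end_near. Qed.

(** The density may take the value +oo, as that of a fractional integral of order
    less than 1 can; hence the passage to the limit through simple functions
    instead of a Radon-Nikodym derivative. *)
Lemma ge0_integral_density (f : T -> \bar R) :
  measurable_fun setT f -> (forall x, 0 <= f x) ->
  \int[nu]_x f x = \int[mu]_x (f x * g x).
Proof.
move=> mf f0; pose h := nnsfun_approx measurableT mf.
have nd x : {homo (fun n => h n x) : m n / (m <= n)%N >-> (m <= n)%R}.
  by move=> a b ab; exact/lefP/nd_nnsfun_approx.
have hf x : (EFin \o h n) x @[n --> \oo] --> f x.
  exact: (cvg_nnsfun_approx measurableT mf (fun x _ => f0 x)).
transitivity (limn (fun n => \int[nu]_x (h n x)%:E)).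
  rewrite -monotone_convergence//.
  - by apply: eq_integral => x _; apply/esym/cvg_lim => //; exact: hf.
  - by move=> n; exact/measurable_EFinP.
  - by move=> n x _; rewrite lee_fin.
  - by move=> x _ a b ab; rewrite lee_fin; exact: nd.
transitivity (limn (fun n => \int[mu]_x ((h n x)%:E * g x))).
  by congr (limn _); apply/funext => n; exact: integral_density_nnsfun.
rewrite -monotone_convergence//.
- apply: eq_integral => x _; apply/cvg_lim => //.
  by apply: (cvg_muler (u := h ^~ x)) => //; exact: hf.
- by move=> n; apply: emeasurable_funM => //; exact/measurable_EFinP.
- by move=> n x _; rewrite mule_ge0// lee_fin.
- by move=> x _ a b ab; rewrite lee_wpmul2r// lee_fin; exact/lefP/nd_nnsfun_approx.
Qed.

End density.

(** The image of a measure as a bundled measure; a pushforward leaves the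
    measurability of the map as an unresolved argument of its measure structure. *)
Definition image_measure d1 d2 (T1 : measurableType d1) (T2 : measurableType d2)
    (R : realType) (m : {measure set T1 -> \bar R}) (f : T1 -> T2)
    (mf : measurable_fun setT f) : {measure set T2 -> \bar R}.
Proof. by refine (pushforward m f : {measure set T2 -> \bar R}). Defined.

Lemma ge0_integral_image d1 d2 (T1 : measurableType d1) (T2 : measurableType d2)
    (R : realType) (m : {measure set T1 -> \bar R}) (f : T1 -> T2)
    (mf : measurable_fun setT f) (g : T2 -> \bar R) :
  measurable_fun setT g -> (forall x, 0 <= g x)%E ->
  (\int[image_measure m mf]_x g x = \int[m]_x g (f x))%E.
Proof. by move=> mg g0; rewrite ge0_integral_pushforward. Qed.

Section affine.
Local Open Scope ereal_scope.
Context {R : realType}.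
Local Notation leb := (@lebesgue_measure R).

Let affine_measurable (c d : R) :
  measurable_fun [set: measurableTypeR R]
    ((fun x : measurableTypeR R => c * x + d)%R : _ -> measurableTypeR R).
Proof. by apply: measurable_funD => //; exact: measurable_funM. Qed.

(** Lebesgue measure is determined by its values on intervals, and the scaled
    image under an affine map has the same values. *)
Lemma ge0_integral_affine (c d : R) (f : R -> \bar R) : (0 < c)%R ->
  measurable_fun setT f -> (forall x, 0 <= f x) ->
  \int[leb]_x f x = c%:E * \int[leb]_x f (c * x + d)%R.
Proof.
move=> c0 mf f0.
pose k : {nonneg R} := NngNum (ltW c0).
transitivity (\int[mscale k (image_measure leb (affine_measurable c d))]_x f x).
  apply: eq_measure_integral => //= A mA _.
  apply: lebesgue_measure_unique => // _ [[a b]] _ <-.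
  rewrite -[RHS]/(c%:E * leb ((fun x : R => c * x + d)%R @^-1` `]a, b])).
  rewrite (_ : _ @^-1` _ = `](a - d) / c, (b - d) / c]%classic)%R; last first.
    apply/seteqP; split => x /=; rewrite !in_itv/=;
      by rewrite ltr_pdivrMr// ler_pdivlMr// ltrBlDr lerBrDr [(x * c)%R]mulrC.
  rewrite !lebesgue_measure_itv/= !lte_fin ltr_pM2r ?invr_gt0// ltrD2r.
  case: ifPn => _; last by rewrite mule0.
  by rewrite -!EFinB -EFinM -mulrBl mulrCA divff ?gt_eqF// mulr1 opprB addrA subrK.
rewrite ge0_integral_mscale//.
by rewrite ge0_integral_image.
Qed.
End affine.

(** * Truncated powers and the Euler integrals *)

Section truncated_powers.
Context {R : realType}.
Local Notation leb := (@lebesgue_measure R).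
Implicit Types a b c x y z u v : R.

(** The kernel of fractional integration of order [a], without its factor
    [1 / Gamma(a)]. The cut-off turns integrals over [0 <= u < y] into integrals
    over the whole line. *)
Definition tpow a x : R := if 0 < x then x `^ (a - 1) else 0.

Lemma tpow_ge0 a x : 0 <= tpow a x.
Proof. by rewrite /tpow; case: ifPn => // _; exact: powR_ge0. Qed.

Lemma tpow_le0 a x : x <= 0 -> tpow a x = 0.
Proof. by rewrite /tpow leNgt => /negbTE ->. Qed.

Lemma measurable_tpow a : measurable_fun [set: R] (tpow a).
Proof.
apply: measurable_fun_if => //=.
- by apply: measurable_fun_ltr.
- by apply: measurable_funTS.
Qed.

Lemma tpowZ a c x : 0 < c -> tpow a (c * x) = c `^ (a - 1) * tpow a x.
Proof.
move=> c0; rewrite /tpow pmulr_rgt0//; case: ifPn => x0; last by rewrite mulr0.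
by rewrite powRM// ltW.
Qed.

Lemma tpow_natS n x : 0 < x -> tpow n.+1%:R x = x ^+ n.
Proof.
by move=> x0; rewrite /tpow x0 -natr1 addrK powR_mulrn// ltW.
Qed.

(** Euler's Beta integral. *)
Definition eBeta a b : \bar R := (\int[leb]_x (tpow a x * tpow b (1 - x))%:E)%E.

(** Euler's Gamma integral, with values in the extended reals so that no
    convergence is needed to manipulate it. *)
Definition eGamma a : \bar R := (\int[leb]_x (tpow a x * expR (- x))%:E)%E.

Lemma eGammaE a : (eGamma a = \int[leb]_(x in `]0%R, +oo[) (x `^ (a - 1) * expR (- x))%:E)%E.
Proof.
rewrite /eGamma [RHS]integral_mkcond; apply: eq_integral => x _.
rewrite patchE /tpow; case: ifPn => x0.
  by rewrite mem_set//= in_itv/= x0.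
by rewrite memNset ?mul0r//= in_itv/= andbT; exact/negP.
Qed.

Let measurable_beta_integrand a b z :
  measurable_fun [set: R] (fun x => tpow a x * tpow b (z - x)).
Proof.
apply: measurable_funM; first exact: measurable_tpow.
apply: measurableT_comp; first exact: measurable_tpow.
by apply: measurable_funB.
Qed.

(** By scaling, a convolution of truncated powers is again a truncated power. *)
Lemma tpow_conv a b z :
  (\int[leb]_x (tpow a x * tpow b (z - x))%:E = eBeta a b * (tpow (a + b) z)%:E)%E.
Proof.
have [z0|z0] := leP z 0.
  rewrite (tpow_le0 _ z0) mule0 integral0_eq// => x _.
  have [x0|x0] := leP x 0; first by rewrite (tpow_le0 _ x0) mul0r.
  by rewrite (@tpow_le0 b) ?mulr0// subr_le0 (le_trans z0)// ltW.
rewrite (@ge0_integral_affine _ z 0)//; last 2 first.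
- by apply/measurable_EFinP; exact: measurable_beta_integrand.
- by move=> x; rewrite lee_fin mulr_ge0 ?tpow_ge0.
have E x : tpow a (z * x + 0) * tpow b (z - (z * x + 0)) =
    z `^ (a + b - 2) * (tpow a x * tpow b (1 - x)).
  rewrite addr0 -{2}(mulr1 z) -mulrBr !tpowZ//.
  have -> : a + b - 2 = (a - 1) + (b - 1) by ring.
  rewrite [X in _ = X * _]powRD ?(gt_eqF z0) ?implybT//; ring.
under eq_integral do rewrite E EFinM.
rewrite ge0_integralZl//; last 3 first.
- by apply/measurable_EFinP; exact: measurable_beta_integrand.
- by move=> x _; rewrite lee_fin mulr_ge0 ?tpow_ge0.
- by rewrite lee_fin powR_ge0.
rewrite muleA muleC; congr (_ * _)%E.
rewrite /tpow z0 -EFinM; congr EFin.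
have -> : a + b - 1 = 1 + (a + b - 2) by ring.
by rewrite [RHS]powRD ?(gt_eqF z0) ?implybT// powRr1// ltW.
Qed.

Lemma tpow_conv_shift a b u y :
  (\int[leb]_v (tpow b (y - v) * tpow a (v - u))%:E =
   eBeta a b * (tpow (a + b) (y - u))%:E)%E.
Proof.
rewrite (@ge0_integral_affine _ 1 u)//; last 2 first.
- apply/measurable_EFinP/measurable_funM.
    by apply: measurableT_comp; [exact: measurable_tpow|exact: measurable_funB].
  by apply: measurableT_comp; [exact: measurable_tpow|exact: measurable_funB].
- by move=> x; rewrite lee_fin mulr_ge0 ?tpow_ge0.
rewrite mul1e -tpow_conv; apply: eq_integral => x _.
by rewrite mul1r addrK mulrC (_ : y - (x + u) = y - u - x)//; ring.
Qed.

(** Integrate the convolution identity [tpow_conv] against [expR (- z)] and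
    exchange the order of integration. *)
Lemma eGammaM a b : (eGamma a * eGamma b = eBeta a b * eGamma (a + b))%E.
Proof.
have mG c : measurable_fun [set: R] (fun x => (tpow c x * expR (- x))%:E).
  apply/measurable_EFinP/measurable_funM; first exact: measurable_tpow.
  by apply: measurableT_comp => //; exact: measurableT_comp.
have G0 c x : (0 <= (tpow c x * expR (- x))%:E)%E.
  by rewrite lee_fin mulr_ge0 ?tpow_ge0 ?expR_ge0.
have Gge0 c : (0 <= eGamma c)%E by apply: integral_ge0.
pose k (p : R * R) := (tpow a p.1 * tpow b (p.2 - p.1) * expR (- p.2))%:E.
have mk : measurable_fun setT k.
  apply/measurable_EFinP/measurable_funM; first apply/measurable_funM.
  - by apply: measurableT_comp; [exact: measurable_tpow|].
  - by apply: measurableT_comp; [exact: measurable_tpow|exact: measurable_funB].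
  - by apply: measurableT_comp => //; exact: measurableT_comp.
have k0 p : (0 <= k p)%E by rewrite lee_fin !mulr_ge0 ?tpow_ge0 ?expR_ge0.
transitivity (\int[leb]_x \int[leb]_z k (x, z))%E.
  rewrite {1}/eGamma -ge0_integralZr//; last exact: mG.
  apply: eq_integral => x _.
  rewrite (@ge0_integral_affine _ 1 x _ ltr01)//; last first.
    by apply: measurableT_comp => //; exact: measurable_pair1.
  rewrite mul1e /eGamma -ge0_integralZl//; last exact: mG.
  apply: eq_integral => t _; rewrite /k/= mul1r addrK -EFinM.
  by congr EFin; rewrite opprD expRD; ring.
transitivity (\int[leb]_z \int[leb]_x k (x, z))%E.
  exact: (fubini_tonelli (m1 := leb) (m2 := leb) k mk k0).
transitivity (\int[leb]_z (eBeta a b * (tpow (a + b) z * expR (- z))%:E))%E.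
  apply: eq_integral => z _; rewrite EFinM muleA -tpow_conv.
  rewrite -ge0_integralZr//; last 2 first.
  - by apply/measurable_EFinP; exact: measurable_beta_integrand.
  - by move=> x _; rewrite lee_fin mulr_ge0 ?tpow_ge0.
rewrite ge0_integralZl//; first exact: mG.
by apply: integral_ge0 => x _; rewrite lee_fin mulr_ge0 ?tpow_ge0.
Qed.

End truncated_powers.

Section integrability.
Context {R : realType}.
Local Notation leb := (@lebesgue_measure R).
Implicit Types a b c r s t x y z : R.

Lemma integral_powR r s t : r != 0 -> 0 < s -> s < t ->
  (\int[leb]_(x in `[s, t]) (x `^ (r - 1))%:E = ((t `^ r - s `^ r) / r)%:E)%E.
Proof.
move=> r0 s0 st.
have cF p x : 0 < x -> {for x, continuous (fun y => y `^ p)}.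
  move=> x0; apply: differentiable_continuous; apply/derivable1_diffP.
  by apply: derivable_powR; rewrite in_itv/= x0.
have cG x : 0 < x -> {for x, continuous (fun y => r^-1 * y `^ r)}.
  by move=> x0; apply: cvgM; [exact: cvg_cst|exact: cF].
rewrite (@continuous_FTC2 _ _ (fun x => r^-1 * x `^ r))//.
- by rewrite -EFinB -mulrBr mulrC.
- apply: continuous_in_subspaceT => x; rewrite inE/= in_itv/= => /andP[sx _].
  exact/cF/(lt_le_trans s0).
- split=> [x| |].
  + rewrite in_itv/= => /andP[sx _]; apply: derivableM => //.
    by apply: derivable_powR; rewrite in_itv/= andbT (lt_trans s0).
  + by apply: cvg_at_right_filter; exact: cG.
  + by apply: cvg_at_left_filter; apply: cG; exact: lt_trans st.
- move=> x; rewrite in_itv/= => /andP[sx _].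
  have x0 : 0 < x by exact: lt_trans sx.
  rewrite derive1Ml; last by apply: derivable_powR; rewrite in_itv/= x0.
  by rewrite powR_derive1 ?in_itv/= ?x0// mulrA mulVf// mul1r.
Qed.

Let integral_bigcup_le (F : (set R)^nat) (f : R -> \bar R) (M : \bar R) :
  nondecreasing_seq F -> (forall i, measurable (F i)) ->
  measurable_fun setT f -> (forall x, 0 <= f x)%E ->
  (forall i, \int[leb]_(x in F i) f x <= M)%E ->
  (\int[leb]_(x in \bigcup_i F i) f x <= M)%E.
Proof.
move=> ndF mF mf f0 FM.
have FE : (\int[leb]_(x in F i) f x)%E @[i --> \oo] -->
    (\int[leb]_(x in \bigcup_i F i) f x)%E.
  by apply: ge0_nondecreasing_set_cvg_integral => // i; exact: measurable_funTS.
rewrite -(cvg_lim _ FE)//; apply: lime_le; first by apply/cvg_ex; eexists; exact: FE.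
exact: nearW.
Qed.

(** A common source for the convergence of the Gamma integral ([phi x] is
    [expR (- x)]) and of the constant factor in [integral_weight_tpow] ([phi x] is
    [(1 + x) `^ (- (alpha + a))]). The two ends of the half-line are compared with
    the integrable powers [x `^ (a - 1)] near 0 and [x `^ (- c - 1)] near infinity. *)
Lemma integral_tpow_lty a c (K : R) (phi : R -> R) :
  0 < a -> 0 < c -> 0 <= K -> measurable_fun setT phi ->
  (forall x, 0 <= x -> 0 <= phi x <= 1) ->
  (forall x, 1 <= x -> phi x <= K * x `^ (- (a + c))) ->
  (\int[leb]_x (tpow a x * phi x)%:E < +oo)%E.
Proof.
move=> a0 c0 K0 mphi phi01 phiK.
have tphi x : 0 <= tpow a x * phi x.
  have [x0|x0] := leP x 0; first by rewrite tpow_le0// mul0r.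
  by rewrite mulr_ge0 ?tpow_ge0//; case/andP: (phi01 x (ltW x0)).
have mtphi : measurable_fun setT (fun x => (tpow a x * phi x)%:E).
  by apply/measurable_EFinP/measurable_funM => //; exact: measurable_tpow.
have mpow p D : measurable_fun D (fun x : R => (x `^ p)%:E).
  by apply: measurable_funTS; exact/measurable_EFinP.
have near0 : (\int[leb]_(x in `]0%R, 1%R]) (tpow a x * phi x)%:E <= (a^-1)%:E)%E.
  rewrite (_ : `]0%R, 1%R]%classic = \bigcup_i `[i.+2%:R^-1, 1%R]%classic); last first.
    apply/seteqP; split => [x/=|x [i _]/=]; rewrite !in_itv/=.
      move=> /andP[x0 x1]; exists (Num.truncn x^-1) => //=; rewrite in_itv/= x1 andbT.
      rewrite -[leRHS]invrK lef_pV2 ?posrE ?invr_gt0//.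
      by rewrite ltW// (lt_trans (truncnS_gt _))// ltr_nat.
    by move=> /andP[ix ->]; rewrite (lt_le_trans _ ix)// invr_gt0.
  apply: integral_bigcup_le => //.
  - apply/nondecreasing_seqP => n; apply/subsetPset; apply: subset_itvr.
    by rewrite bnd_simp lef_pV2 ?posrE// ler_nat.
  - move=> n.
    have n0 : 0 < n.+2%:R^-1 :> R by rewrite invr_gt0.
    have n1 : n.+2%:R^-1 < 1 :> R by rewrite invf_lt1// ltr1n.
    apply: (@le_trans _ _ (\int[leb]_(x in `[n.+2%:R^-1%R, 1%R]) (x `^ (a - 1))%:E)%E).
      apply: ge0_le_integral => //.
      + by move=> x _; rewrite lee_fin.
      + exact: measurable_funTS.
      + exact: mpow.
      + move=> x; rewrite /= in_itv/= => /andP[nx x1].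
        have x0 : 0 < x by exact: lt_le_trans nx.
        rewrite lee_fin /tpow x0 ler_piMr ?powR_ge0//.
        by case/andP: (phi01 x (ltW x0)).
    rewrite integral_powR ?gt_eqF// powR1 lee_fin -[leRHS]mul1r ler_pM2r ?invr_gt0// gerBl powR_ge0.
have nearoo : (\int[leb]_(x in `[1%R, +oo[) (tpow a x * phi x)%:E <= (K / c)%:E)%E.
  rewrite (_ : `[1%R, +oo[%classic = \bigcup_i `[1%R, i.+2%:R]%classic); last first.
    apply/seteqP; split => [x/=|x [i _]/=]; rewrite !in_itv/= ?andbT.
      move=> x1; exists (Num.truncn x) => //=; rewrite in_itv/= x1/=.
      by rewrite ltW// (lt_trans (truncnS_gt _))// ltr_nat.
    by case/andP.
  apply: integral_bigcup_le => //.
  - apply/nondecreasing_seqP => n; apply/subsetPset; apply: subset_itvl.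
    by rewrite bnd_simp ler_nat.
  - move=> n.
    apply: (@le_trans _ _ (\int[leb]_(x in `[1%R, n.+2%:R%R]) (K%:E * (x `^ (- c - 1))%:E))%E).
      apply: ge0_le_integral => //.
      + by move=> x _; rewrite lee_fin.
      + exact: measurable_funTS.
      + by apply: measurable_funeM; exact: mpow.
      + move=> x; rewrite /= in_itv/= => /andP[x1 _].
        have x0 : 0 < x by exact: lt_le_trans x1.
        rewrite -EFinM lee_fin /tpow x0 (_ : - c - 1 = (a - 1) + (- (a + c))); last by ring.
        rewrite [X in K * X]powRD ?(gt_eqF x0) ?implybT//.
        by rewrite [leRHS]mulrCA ler_wpM2l ?powR_ge0//; exact: phiK.
    rewrite ge0_integralZl//; last 2 first.
    - exact: mpow.
    - by move=> x _; rewrite lee_fin powR_ge0.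
    rewrite integral_powR ?oppr_eq0 ?gt_eqF ?ltr1n// powR1 -EFinM lee_fin ler_wpM2l//.
    rewrite invrN mulrN -mulNr opprB -[leRHS]mul1r ler_pM2r ?invr_gt0// gerBl powR_ge0.
have -> : (\int[leb]_x (tpow a x * phi x)%:E =
    \int[leb]_(x in `]0%R, 1%R] `|` `]1%R, +oo[) (tpow a x * phi x)%:E)%E.
  rewrite [RHS]integral_mkcond; apply: eq_integral => x _; rewrite patchE.
  case: ifPn => //; rewrite notin_setE/= !in_itv/= andbT => x01.
  rewrite tpow_le0 ?mul0r// leNgt; apply/negP => x0; apply: x01.
  by have [x1|x1] := leP x 1; [left; rewrite x0|right].
rewrite ge0_integral_setU//=.
- apply: lte_add_pinfty; first exact: le_lt_trans near0 (ltry _).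
  apply: le_lt_trans (ltry (K / c)); apply: le_trans nearoo.
  apply: ge0_subset_integral => //.
  + exact: measurable_funTS.
  + by move=> x _; rewrite lee_fin.
  + by apply: subset_itvr; rewrite bnd_simp.
- exact: measurable_funTS.
- by move=> x _; rewrite lee_fin.
- apply/disj_setPS => x [/=]; rewrite !in_itv/= andbT => /andP[_ x1].
  by rewrite ltNge x1.
Qed.

End integrability.

Section gamma_beta_values.
Context {R : realType}.
Local Notation leb := (@lebesgue_measure R).
Implicit Types a b c r s t x y z : R.

Let measurable_expRN : measurable_fun [set: R] (fun x => expR (- x)).
Proof. by apply: measurableT_comp => //; exact: measurableT_comp. Qed.

(** With [s = a + 1], the bound [ln (x / s) <= x / s - 1] gives
    [expR (- x) <= s `^ s * x `^ (- s)]. *)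
Lemma eGamma_lty a : 0 < a -> (eGamma a < +oo)%E.
Proof.
move=> a0; have s0 : 0 < a + 1 by exact: addr_gt0.
apply: (@integral_tpow_lty _ a 1 ((a + 1) `^ (a + 1)) (fun x => expR (- x))) => //.
- exact: powR_ge0.
- by move=> x x0; rewrite expR_ge0/= -[leRHS]expR0 ler_expR oppr_le0.
- move=> x x1; have x0 : 0 < x by exact: lt_le_trans x1.
  rewrite /powR !gt_eqF// -expRD ler_expR mulNr -mulrBr -ler_pdivrMl//.
  rewrite mulrN lerNl opprB -ln_div ?posrE//.
  have -> : x / (a + 1) = 1 + (x / (a + 1) - 1) by ring.
  apply: (@le_trans _ _ (x / (a + 1) - 1)).
    by apply: le_ln1Dx; rewrite ltrBrDr addNr divr_gt0.
  by rewrite mulrC lerBlDr lerDl.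
Qed.

Lemma eGamma_gt0 a : (0 < eGamma a)%E.
Proof.
(* A lower bound of the integrand on [1, 2], where [0 <= ln x <= 2]. *)
pose c := expR (- (2 * `|a - 1| + 2)).
apply: (@lt_le_trans _ _ (\int[leb]_(x in `[1%R, 2%R]) c%:E)%E).
  rewrite integral_cst//= lebesgue_measure_itv/= lte_fin ltr1n/= -EFinB -EFinM lte_fin.
  by rewrite mulr_gt0 ?expR_gt0// subr_gt0 ltr1n.
apply: (@le_trans _ _ (\int[leb]_(x in `[1%R, 2%R]) (tpow a x * expR (- x))%:E)%E).
  apply: ge0_le_integral => //.
  - by move=> x _; rewrite lee_fin expR_ge0.
  - apply/measurable_funTS/measurable_EFinP/measurable_funM => //.
    exact: measurable_tpow.
  - move=> x; rewrite /= in_itv/= => /andP[x1 x2].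
    have x0 : 0 < x by exact: lt_le_trans x1.
    rewrite lee_fin /tpow x0 /powR gt_eqF// -expRD ler_expR opprD lerB//.
    have l0 : 0 <= ln x by exact: ln_ge0.
    have l2 : ln x <= 2.
      by rewrite (le_trans _ x2)// ltW// ln_sublinear.
    apply: (@le_trans _ _ (- `|(a - 1) * ln x|)); last exact: lerNnormlW.
    rewrite lerN2 normrM (ger0_norm l0) mulrC ler_wpM2r//.
rewrite /eGamma; apply: ge0_subset_integral => //.
- apply/measurable_EFinP/measurable_funM => //; exact: measurable_tpow.
- by move=> x _; rewrite lee_fin mulr_ge0 ?tpow_ge0 ?expR_ge0.
Qed.

Lemma eGamma_fun a : 0 < a -> eGamma a = (gamma_fun a)%:E.
Proof.
move=> a0; rewrite /gamma_fun /Rintegral -eGammaE fineK//.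
by rewrite ge0_fin_numE ?eGamma_lty// ltW// eGamma_gt0.
Qed.

Lemma gamma_fun_gt0 a : 0 < a -> 0 < gamma_fun a.
Proof. by move=> a0; rewrite -lte_fin -eGamma_fun// eGamma_gt0. Qed.

Lemma eBeta1 n : eBeta 1 n.+1%:R = (n.+1%:R^-1 : R)%:E.
Proof.
have -> : eBeta 1 n.+1%:R = (\int[leb]_(x in `[0%R, 1%R]) ((1 - x) ^+ n)%:E)%E.
  rewrite (@integral_itv_bndoo _ 0 1 _ true false); last first.
    apply/measurable_funTS/measurable_EFinP/measurable_funX; exact: measurable_funB.
  rewrite [RHS]integral_mkcond; apply: eq_integral => x _.
  rewrite patchE; case: ifPn; rewrite ?inE ?notin_setE/= in_itv/=.
    move=> /andP[x0 x1]; rewrite tpow_natS ?subr_gt0//.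
    by rewrite /tpow x0 subrr powRr0 mul1r.
  move/negP; rewrite negb_and -!leNgt => /orP[x0|x1].
    by rewrite tpow_le0 ?mul0r.
  by rewrite (@tpow_le0 _ n.+1%:R) ?mulr0// subr_le0.
(* The integral has a nonzero real part, hence is not infinite. *)
have : fine (\int[leb]_(x in `[0%R, 1%R]) ((1 - x) ^+ n)%:E)%E = n.+1%:R^-1.
  exact: Rintegral_onemXn.
have n0 : n.+1%:R^-1 != 0 :> R by rewrite invr_eq0 pnatr_eq0.
case: integral => [r /= -> //| |] /= /esym/eqP; by rewrite (negbTE n0).
Qed.

Lemma eGamma1 : eGamma 1 = (1 : \bar R)%E.
Proof.
rewrite eGammaE -(@integral_exponential_pdf R 1)//.
transitivity (\int[leb]_(x in `[0%R, +oo[) (expR (- x))%:E)%E.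
  rewrite -integral_itv_obnd_cbnd; last exact/measurable_funTS/measurable_EFinP.
  by apply: eq_integral => x _; rewrite subrr powRr0 mul1r.
rewrite integral_mkcond; apply: eq_integral => x _.
rewrite patchE; case: ifPn; rewrite ?inE ?notin_setE/= in_itv/= andbT.
  by move=> x0; rewrite exponential_pdfE// mul1r mulN1r.
by move=> /negP; rewrite -ltNge => x0; rewrite lt0_exponential_pdf.
Qed.

(** The case [a = 1], [b = n + 1] of [eGammaM]. *)
Lemma eGamma_natS n : eGamma n.+1%:R = (n`!%:R : R)%:E.
Proof.
elim: n => [|n IH]; first by rewrite eGamma1.
have := @eGammaM R 1 n.+1%:R; rewrite eGamma1 mul1e IH eBeta1 nat1r.
have n0 : n.+1%:R != 0 :> R by rewrite pnatr_eq0.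
move=> /(congr1 (fun z : \bar R => n.+1%:R%:E * z)%E).
by rewrite muleA -!EFinM divff// mul1e factS natrM.
Qed.

End gamma_beta_values.

(** * Fractional integration of measures on the line *)

Section fractional_density.
Context {R : realType}.
Local Notation leb := (@lebesgue_measure R).
Implicit Types a b s u v x y z alpha : R.

(** Up to the factor [1 / Gamma(a)], the density of the fractional integral of
    order [a] of [m]. *)
Definition frac_density a (m : {measure set (measurableTypeR R) -> \bar R}) y : \bar R :=
  (\int[m]_u (tpow a (y - u))%:E)%E.

Lemma frac_density_ge0 a m y : (0 <= frac_density a m y)%E.
Proof. by apply: integral_ge0 => u _; rewrite lee_fin tpow_ge0. Qed.

Let measurable_kernel a (g : R -> R) : measurable_fun setT g ->
  measurable_fun setT (fun p : R * R => (g p.1 * tpow a (p.1 - p.2))%:E).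
Proof.
move=> mg; apply/measurable_EFinP/measurable_funM.
  exact: measurableT_comp.
by apply: measurableT_comp; [exact: measurable_tpow|exact: measurable_funB].
Qed.

Lemma measurable_frac_density a
    (m : {sigma_finite_measure set (measurableTypeR R) -> \bar R}) :
  measurable_fun [set: R] (frac_density a m).
Proof.
have k0 (p : R * R) : (0 <= (1 * tpow a (p.1 - p.2))%:E)%E.
  by rewrite lee_fin mul1r tpow_ge0.
have mk := @measurable_kernel a (fun=> 1) (@measurable_cst _ _ _ _ _ (1 : R)).
have := measurable_fun_fubini_tonelli_F (m2 := m) _ mk k0.
apply: eq_measurable_fun => y _; rewrite /fubini_F /frac_density.
by apply: eq_integral => u _; rewrite /= mul1r.
Qed.

(** The exchange of the two integrations is Tonelli's theorem. *)
Lemma integral_frac_density a (g : R -> R)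
    (m : {sigma_finite_measure set (measurableTypeR R) -> \bar R}) :
  measurable_fun setT g -> (forall v, 0 <= g v) ->
  (\int[leb]_v ((g v)%:E * frac_density a m v) =
   \int[m]_u \int[leb]_v (g v * tpow a (v - u))%:E)%E.
Proof.
move=> mg g0.
pose k (p : R * R) := (g p.1 * tpow a (p.1 - p.2))%:E.
have k0 p : (0 <= k p)%E by rewrite lee_fin mulr_ge0 ?tpow_ge0.
have E := fubini_tonelli (m1 := leb) (m2 := m) k (measurable_kernel a mg) k0.
rewrite -[RHS]E; apply: eq_integral => v _.
rewrite /frac_density -ge0_integralZl//.
- apply/measurable_EFinP.
  by apply: measurableT_comp; [exact: measurable_tpow|exact: measurable_funB].
- by move=> u _; rewrite lee_fin tpow_ge0.
- by rewrite lee_fin.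
Qed.

(** The semigroup property of fractional integration, up to normalization. *)
Lemma frac_density_conv a b y
    (m : {sigma_finite_measure set (measurableTypeR R) -> \bar R}) :
  (\int[leb]_v ((tpow b (y - v))%:E * frac_density a m v) =
   eBeta a b * frac_density (a + b) m y)%E.
Proof.
rewrite integral_frac_density; last 2 first.
- by apply: measurableT_comp; [exact: measurable_tpow|exact: measurable_funB].
- by move=> v; rewrite tpow_ge0.
under eq_integral do rewrite tpow_conv_shift.
rewrite ge0_integralZl//.
- apply/measurable_EFinP.
  by apply: measurableT_comp; [exact: measurable_tpow|exact: measurable_funB].
- by move=> u _; rewrite lee_fin tpow_ge0.
- by apply: integral_ge0 => v _; rewrite lee_fin mulr_ge0 ?tpow_ge0.
Qed.

(** The substitution [v = (1 + u) t + u] makes the dependence on [u] a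
    single factor. *)
Let integral_weight_tpow alpha a u : 0 <= u ->
  (\int[leb]_v ((1 + v) `^ (- (alpha + a)) * tpow a (v - u))%:E =
   ((1 + u) `^ (- alpha))%:E *
   \int[leb]_t (tpow a t * (1 + t) `^ (- (alpha + a)))%:E)%E.
Proof.
move=> u0; have u1 : 0 < 1 + u by rewrite ltr_pwDl.
have mw : measurable_fun setT (fun x : R => (1 + x) `^ (- (alpha + a))).
  apply: (measurableT_comp (measurable_powR _)); exact: measurable_funD.
rewrite (@ge0_integral_affine _ (1 + u) u)//; last 2 first.
- apply/measurable_EFinP/measurable_funM => //.
  by apply: measurableT_comp; [exact: measurable_tpow|exact: measurable_funB].
- by move=> v; rewrite lee_fin mulr_ge0 ?tpow_ge0 ?powR_ge0.
have E t : (1 + ((1 + u) * t + u)) `^ (- (alpha + a)) * tpow a ((1 + u) * t + u - u) =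
    (1 + u) `^ (- alpha - 1) * (tpow a t * (1 + t) `^ (- (alpha + a))).
  rewrite addrK tpowZ//; have [t0|t0] := leP t 0.
    by rewrite tpow_le0// mul0r !mulr0.
  have -> : 1 + ((1 + u) * t + u) = (1 + u) * (1 + t) by ring.
  rewrite powRM ?addr_ge0// ?(ltW t0)//.
  have -> : - alpha - 1 = - (alpha + a) + (a - 1) by ring.
  by rewrite [in RHS](@powRD _ (1 + u)) ?(gt_eqF u1) ?implybT//; ring.
under eq_integral do rewrite E EFinM.
rewrite ge0_integralZl//; last 3 first.
- apply/measurable_EFinP/measurable_funM => //; exact: measurable_tpow.
- by move=> t _; rewrite lee_fin mulr_ge0 ?tpow_ge0 ?powR_ge0.
- by rewrite lee_fin powR_ge0.
rewrite muleA -EFinM; congr (_%:E * _)%E.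
rewrite -[in RHS](subrK 1 (- alpha)) [RHS]powRD ?(gt_eqF u1) ?implybT//.
by rewrite powRr1 ?(ltW u1)// mulrC.
Qed.

Section half_line.
Variable m : {measure set (measurableTypeR R) -> \bar R}.
Hypothesis supp_m : m `]-oo, 0%R[%classic = 0%E.

Lemma integral_half_line (f : R -> \bar R) :
  measurable_fun setT f -> (forall x, 0 <= f x)%E ->
  (\int[m]_x f x = \int[m]_(x in `[0%R, +oo[) f x)%E.
Proof.
move=> mf f0; rewrite (ge0_negligible_integral _ _ _ _ supp_m)//.
congr (integral _ _ _); rewrite setTD setCitvl//.
Qed.

Lemma frac_density_le0 a y : y <= 0 -> frac_density a m y = 0%E.
Proof.
move=> y0; rewrite /frac_density integral_half_line; last 2 first.
- apply/measurable_EFinP.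
  by apply: measurableT_comp; [exact: measurable_tpow|exact: measurable_funB].
- by move=> u; rewrite lee_fin tpow_ge0.
apply: integral0_eq => u; rewrite /= in_itv/= andbT => u0.
by rewrite tpow_le0// subr_le0 (le_trans y0).
Qed.

(** For [0 <= x < y] the weight is at least its value at [y], which is positive. *)
Lemma measure_lty_of_weight alpha y : 0 < alpha ->
  (\int[m]_x ((1 + x) `^ (- alpha))%:E < +oo)%E -> (m `]-oo, y[%classic < +oo)%E.
Proof.
move=> al0 fin.
have mw : measurable_fun setT (fun x : R => ((1 + x) `^ (- alpha))%:E).
  apply/measurable_EFinP; apply: (measurableT_comp (measurable_powR _)).
  exact: measurable_funD.
have w0 x : (0 <= ((1 + x) `^ (- alpha))%:E)%E by rewrite lee_fin powR_ge0.
have [y0|y0] := leP y 0.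
  apply: (@le_lt_trans _ _ 0%E) => //; rewrite -supp_m le_measure ?inE//.
  by apply: subset_itvl; rewrite bnd_simp.
have c0 : 0 < (1 + y) `^ (- alpha) by apply: powR_gt0; rewrite addr_gt0.
have fin0y : (m `[0%R, y[%classic < +oo)%E.
  rewrite -(@lte_pmul2l _ ((1 + y) `^ (- alpha))%:E) ?lte_fin// gt0_muley ?lte_fin//.
  apply: le_lt_trans fin; rewrite -integral_cst//.
  apply: (@le_trans _ _ (\int[m]_(x in `[0%R, y[) ((1 + x) `^ (- alpha))%:E)%E); last first.
    by apply: ge0_subset_integral => //.
  apply: ge0_le_integral => //.
  - by move=> x _; rewrite lee_fin ltW.
  - exact: measurable_funTS.
  - move=> x; rewrite /= in_itv/= => /andP[x0 xy].
  rewrite lee_fin !powRN lef_pV2 ?posrE ?powR_gt0 ?ltr_pwDl ?(ltW y0)//.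
  apply: ge0_ler_powR; rewrite ?nnegrE ?addr_ge0// ?(ltW al0)// ?(ltW y0)//.
  by rewrite lerD2l ltW.
apply: (@le_lt_trans _ _ (m `]-oo, 0%R[%classic + m `[0%R, y[%classic)%E).
  rewrite (_ : `]-oo, y[%classic = `]-oo, 0%R[ `|` `[0%R, y[)//.
    by apply: measureU2.
  by rewrite -(@itv_bndbnd_setU _ _ _ (BLeft 0))// bnd_simp ltW.
by rewrite supp_m add0e.
Qed.

End half_line.

(** By Tonelli's theorem and [integral_weight_tpow] this integral is a finite
    constant times the integral of the weight of exponent [alpha] against [m]. *)
Lemma integral_weight_frac_density alpha a
    (m : {sigma_finite_measure set (measurableTypeR R) -> \bar R}) :
  0 < alpha -> 0 < a -> m `]-oo, 0%R[%classic = 0%E ->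
  (\int[m]_x ((1 + x) `^ (- alpha))%:E < +oo)%E ->
  (\int[leb]_v (((1 + v) `^ (- (alpha + a)))%:E * frac_density a m v) < +oo)%E.
Proof.
move=> al0 a0 supp fin.
have mw p : measurable_fun setT (fun x : R => (1 + x) `^ p).
  apply: (measurableT_comp (measurable_powR _)); exact: measurable_funD.
rewrite integral_frac_density//; last by move=> v; exact: powR_ge0.
have mk : measurable_fun setT
    (fun p : R * R => ((1 + p.1) `^ (- (alpha + a)) * tpow a (p.1 - p.2))%:E).
  exact: (@measurable_kernel a (fun v => (1 + v) `^ (- (alpha + a)))).
have k0 (p : R * R) : (0 <= ((1 + p.1) `^ (- (alpha + a)) * tpow a (p.1 - p.2))%:E)%E.
  by rewrite lee_fin mulr_ge0 ?tpow_ge0 ?powR_ge0.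
rewrite integral_half_line//; last 2 first.
- exact: (measurable_fun_fubini_tonelli_G (m1 := leb) _ mk k0).
- by move=> u; apply: integral_ge0 => v _; rewrite lee_fin mulr_ge0 ?tpow_ge0 ?powR_ge0.
pose D := (\int[leb]_t (tpow a t * (1 + t) `^ (- (alpha + a)))%:E)%E.
have D0 : (0 <= D)%E.
  by apply: integral_ge0 => v _; rewrite lee_fin mulr_ge0 ?tpow_ge0 ?powR_ge0.
have Doo : (D < +oo)%E.
  apply: (@integral_tpow_lty _ a alpha 1) => //.
  - move=> x x0; rewrite powR_ge0/= powRN invf_le1 ?powR_gt0 ?ltr_pwDl//.
    rewrite -[leLHS](powRr0 (1 + x)) ler_powR ?lerDl//.
    by rewrite addr_ge0// ltW.
  - move=> x x1; have x0 : 0 < x by exact: lt_le_trans x1.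
    rewrite mul1r [a + alpha]addrC !powRN lef_pV2 ?posrE ?powR_gt0 ?ltr_pwDl ?(ltW x0)//.
    apply: ge0_ler_powR; rewrite ?nnegrE ?addr_ge0 ?(ltW x0) ?(ltW al0) ?(ltW a0)//.
    by rewrite lerDr.
rewrite (_ : integral _ _ _ =
    \int[m]_(u in `[0%R, +oo[) (D * ((1 + u) `^ (- alpha))%:E))%E; last first.
  apply: eq_integral => u; rewrite inE/= in_itv/= andbT => u0.
  by rewrite integral_weight_tpow// muleC.
rewrite ge0_integralZl//; last 2 first.
- by apply: measurable_funTS; apply/measurable_EFinP; exact: mw.
- by move=> u _; rewrite lee_fin powR_ge0.
rewrite -integral_half_line//; last 2 first.
- by apply/measurable_EFinP; exact: mw.
- by move=> u; rewrite lee_fin powR_ge0.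
apply: lte_mul_pinfty => //.
by rewrite ge0_fin_numE.
Qed.

End fractional_density.

(** * Derivatives and left derivatives from bounds on increments *)

Section left_derivatives.
Context {R : realType}.
Implicit Types (f g : R -> R) (h x y : R).

(** The difference quotients of [f] at [y] lie between [g y] and [g (h + y)]; for
    negative increments this is the condition at [h + y]. A primitive of a
    nondecreasing function has this property. *)
Definition increments_between f g := forall y h, 0 <= h ->
  h * g y <= f (h + y) - f y <= h * g (h + y).

Let quotient_dist f g y h : increments_between f g -> h != 0 ->
  `|g y - h^-1 * (f (h + y) - f y)| <= `|g y - g (h + y)|.
Proof.
move=> fg h0; have [hneg|hpos|h0'] := ltgtP h 0; last by rewrite h0' eqxx in h0.
- have Nh0 : 0 <= - h by rewrite oppr_ge0 ltW.
  have := fg (h + y) (- h) Nh0; rewrite addKr => /andP[lo hi].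
  have lo' : h^-1 * (f (h + y) - f y) <= g y.
    by rewrite ler_ndivrMl//; lra.
  have hi' : g (h + y) <= h^-1 * (f (h + y) - f y).
    by rewrite ler_ndivlMl//; lra.
  by rewrite !ger0_norm ?subr_ge0// ?lerD2l ?lerN2// (le_trans hi').
- have /andP[lo hi] := fg y h (ltW hpos).
  have lo' : g y <= h^-1 * (f (h + y) - f y) by rewrite ler_pdivlMl.
  have hi' : h^-1 * (f (h + y) - f y) <= g (h + y) by rewrite ler_pdivrMl.
  rewrite [leRHS]distrC [leLHS]distrC !ger0_norm ?subr_ge0// ?lerD2r//.
  exact: le_trans hi'.
Qed.

Lemma cvg_quotient f g y (F : set_system R) {FF : Filter F} :
  increments_between f g -> (\forall h \near F, h != 0) ->
  g (h + y) @[h --> F] --> g y ->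
  h^-1 * (f (h + y) - f y) @[h --> F] --> g y.
Proof.
move=> fg F0 /cvgrPdist_le Fg; apply/cvgrPdist_le => e e0.
near=> h; apply: le_trans (quotient_dist _ fg _) _; first by near: h.
by near: h; exact: Fg.
Unshelve. all: by end_near. Qed.

Let neq0_left : \forall h \near (0 : R)^'-, h != 0.
Proof. by near=> h; rewrite lt_eqF//; near: h; exact: nbhs_left_lt. Unshelve. all: by end_near. Qed.

Lemma left_derivable_increments f g y : increments_between f g ->
  g (h + y) @[h --> 0^'-] --> g y -> left_derivable f y.
Proof. by move=> fg gy; apply/cvg_ex; exists (g y); exact: cvg_quotient. Qed.

Lemma left_derive_increments f g y : increments_between f g ->
  g (h + y) @[h --> 0^'-] --> g y -> left_derive f y = g y.
Proof. by move=> fg gy; apply/cvg_lim => //; exact: cvg_quotient. Qed.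

Lemma is_derive_increments f g y : increments_between f g ->
  g (h + y) @[h --> 0] --> g y -> is_derive y 1 f (g y).
Proof.
move=> fg gy.
have q : h^-1 *: (f (h *: 1 + y) - f y) @[h --> 0^'] --> g y.
  under eq_fun do rewrite [_ *: 1]mulr1.
  apply: cvg_quotient => //; first by near=> h; near: h; exact: nbhs_dnbhs_neq.
  by apply: cvg_trans gy; apply: cvg_app; exact: nbhs_dnbhs.
by split; [apply/cvg_ex; exists (g y)|apply/cvg_lim].
Unshelve. all: by end_near. Qed.

Lemma increments_betweenZ c f g : 0 <= c -> increments_between f g ->
  increments_between (fun x => c * f x) (fun x => c * g x).
Proof.
move=> c0 fg y h h0; have /andP[lo hi] := fg y h h0.
by rewrite -mulrBr !(mulrCA h) !ler_wpM2l.
Qed.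

End left_derivatives.

(** * Iterated primitives of a distribution function *)

Section iterated_primitives.
Context {R : realType}.
Implicit Types h x y : R.

(** The function [x ^+ k / k!] cut off to 0 for [x <= 0]. *)
Definition divided_tpow k x : R := tpow k.+1%:R x / k`!%:R.

Lemma divided_tpow_ge0 k x : 0 <= divided_tpow k x.
Proof. by rewrite divr_ge0 ?tpow_ge0. Qed.

Lemma divided_tpow_le0 k x : x <= 0 -> divided_tpow k x = 0.
Proof. by move=> x0; rewrite /divided_tpow tpow_le0// mul0r. Qed.

Lemma measurable_divided_tpow k : measurable_fun [set: R] (divided_tpow k).
Proof. by apply: measurable_funM => //; exact: measurable_tpow. Qed.

Let power_increment k (a b : R) : 0 <= a -> a <= b ->
  k.+1%:R * a ^+ k * (b - a) <= b ^+ k.+1 - a ^+ k.+1 <= k.+1%:R * b ^+ k * (b - a).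
Proof.
move=> a0 ab; elim: k => [|k IH]; first by rewrite !expr0 !expr1 !mul1r lexx.
have b0 := le_trans a0 ab; have ba0 : 0 <= b - a by rewrite subr_ge0.
have abk : a ^+ k.+1 <= b ^+ k.+1 by rewrite lerXn2r.
have ak0 : 0 <= a ^+ k.+1 by exact: exprn_ge0.
have E : b ^+ k.+2 - a ^+ k.+2 =
    b * (b ^+ k.+1 - a ^+ k.+1) + a ^+ k.+1 * (b - a) by rewrite !exprS; ring.
have E' : b ^+ k.+2 - a ^+ k.+2 =
    a * (b ^+ k.+1 - a ^+ k.+1) + b ^+ k.+1 * (b - a) by rewrite !exprS; ring.
case/andP: IH => lo hi; apply/andP; split.
  rewrite E'; apply: le_trans (lerD (ler_wpM2l a0 lo) (ler_wpM2r ba0 abk)).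
  by rewrite -[k.+2%:R]natr1 !exprS le_eqVlt; apply/orP; left; apply/eqP; ring.
rewrite E; apply: (le_trans (lerD (ler_wpM2l b0 hi) (ler_wpM2r ba0 abk))).
by rewrite -[k.+2%:R]natr1 !exprS le_eqVlt; apply/orP; left; apply/eqP; ring.
Qed.

(** For [x > 0] this is the mean value inequality for the convex function
    [x ^+ k.+1 / k.+1!]. For [x <= 0 < h + x] only the upper bound has content,
    and it holds because [h + x <= h] and [k! <= k.+1!]. *)
Lemma divided_tpow_increment k x h : 0 <= h ->
  divided_tpow k.+1 x + h * divided_tpow k x <= divided_tpow k.+1 (h + x)
    <= divided_tpow k.+1 x + h * divided_tpow k (h + x).
Proof.
move=> h0; have f0 : 0 < (k.+1)`!%:R :> R by rewrite ltr0n fact_gt0.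
have fk0 : 0 < k`!%:R :> R by rewrite ltr0n fact_gt0.
have k1 : 0 < k.+1%:R :> R by rewrite ltr0n.
have [x0|x0] := leP x 0.
  rewrite !(divided_tpow_le0 _ x0) mulr0 !add0r divided_tpow_ge0/=.
  have [hx0|hx0] := leP (h + x) 0.
    by rewrite !(divided_tpow_le0 _ hx0) mulr0.
  rewrite /divided_tpow !tpow_natS// exprS factS natrM invfM.
  rewrite -mulrA ler_pM ?mulr_ge0 ?exprn_ge0 ?invr_ge0 ?(ltW hx0) ?(ltW k1) ?(ltW fk0)//.
    by rewrite gerDl.
  rewrite ler_wpM2l ?exprn_ge0 ?(ltW hx0)// ler_piMl ?invr_ge0 ?(ltW fk0)//.
  by rewrite invf_le1// ler1n.
have hx0 : 0 < h + x by rewrite ltr_wpDl.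
rewrite /divided_tpow !tpow_natS//.
have E z : h * (z / k`!%:R) = k.+1%:R * z * (h + x - x) / (k.+1)`!%:R.
  by rewrite factS natrM addrK; field; rewrite !gt_eqF.
have xhx : x <= h + x by rewrite lerDr.
have /andP[lo hi] := power_increment k (ltW x0) xhx.
rewrite !E -!mulrDl !ler_pM2r ?invr_gt0//.
by rewrite -lerBrDl lo/= -lerBlDl.
Qed.

End iterated_primitives.

Definition finite_below {R : realType} (m : set (measurableTypeR R) -> \bar R) :=
  forall y : R, (m `]-oo, y[%classic < +oo)%E.

Section primitive.
Context {R : realType}.
Implicit Types (h x y : R) (k n : nat).
Variable m : {measure set (measurableTypeR R) -> \bar R}.
Hypothesis supp_m : m `]-oo, 0%R[%classic = 0%E.
Hypothesis fin_m : finite_below m.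

(** The [k]-fold iterated integral of the distribution function of [m]. *)
Definition primitive k y : R := fine (\int[m]_u (divided_tpow k (y - u))%:E)%E.

Local Lemma measurable_kernel k y : measurable_fun setT (fun u : R => (divided_tpow k (y - u))%:E).
Proof.
apply/measurable_EFinP; apply: measurableT_comp; last exact: measurable_funB.
exact: measurable_divided_tpow.
Qed.

Local Lemma kernel_ge0 k y u : (0 <= (divided_tpow k (y - u))%:E)%E.
Proof. by rewrite lee_fin divided_tpow_ge0. Qed.

Local Lemma integral_kernel0 y :
  (\int[m]_u (divided_tpow 0 (y - u))%:E = m `]-oo, y[%classic)%E.
Proof.
transitivity (\int[m]_u (\1_(`]-oo, y[%classic : set R) u)%:E)%E; last first.
  by rewrite integral_indic// setIT.
apply: eq_integral => u _.
congr EFin; rewrite indicE /divided_tpow fact0 divr1.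
have [uy|yu] := ltP u y.
  by rewrite mem_set/= ?in_itv//= tpow_natS ?subr_gt0.
by rewrite memNset/= ?in_itv/= ?tpow_le0 ?subr_le0//; apply/negP; rewrite -leNgt.
Qed.

Local Lemma integral_kernel_lty k y : (\int[m]_u (divided_tpow k (y - u))%:E < +oo)%E.
Proof.
pose c := `|y| ^+ k / k`!%:R.
have c0 : 0 <= c by rewrite divr_ge0 ?exprn_ge0.
apply: (@le_lt_trans _ _ (c%:E * m `]-oo, y[%classic)%E); last first.
  by apply: lte_mul_pinfty => //; exact: fin_m.
have mck : measurable_fun setT (fun u : R => c%:E * (divided_tpow 0 (y - u))%:E)%E.
  by apply: measurable_funeM; exact: measurable_kernel.
rewrite -integral_kernel0 -ge0_integralZl//; last first.
- by move=> u _; exact: kernel_ge0.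
- exact: measurable_kernel.
rewrite (integral_half_line supp_m (measurable_kernel k y) (kernel_ge0 k y)).
rewrite (integral_half_line supp_m mck); last first.
  by move=> u; rewrite mule_ge0// ?lee_fin// divided_tpow_ge0.
apply: ge0_le_integral => //.
- by move=> u _; exact: kernel_ge0.
- by apply: measurable_funTS; exact: measurable_kernel.
- exact: measurable_funTS.
move=> u; rewrite /= in_itv/= andbT => u0; rewrite -EFinM lee_fin.
have [yu|yu] := leP (y - u) 0; first by rewrite !divided_tpow_le0// mulr0.
rewrite /divided_tpow !tpow_natS// expr0 divr1 mulr1 ler_pM2r ?invr_gt0 ?ltr0n ?fact_gt0//.
rewrite lerXn2r ?nnegrE ?(ltW yu)// (le_trans _ (ler_norm _))//.
by rewrite gerBl.
Qed.

Lemma primitiveE k y :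
  (\int[m]_u (divided_tpow k (y - u))%:E)%E = (primitive k y)%:E.
Proof.
rewrite /primitive fineK// ge0_fin_numE ?integral_kernel_lty// integral_ge0//.
by move=> u _; exact: kernel_ge0.
Qed.

Lemma primitive0E y : m `]-oo, y[%classic = (primitive 0 y)%:E.
Proof. by rewrite -primitiveE integral_kernel0. Qed.

Lemma primitive_ge0 k y : 0 <= primitive k y.
Proof. by rewrite fine_ge0// integral_ge0// => u _; exact: kernel_ge0. Qed.

(** Integrate [divided_tpow_increment] against [m]. *)
Lemma primitive_increments k : increments_between (primitive k.+1) (primitive k).
Proof.
move=> y h h0.
have hu u : h + y - u = h + (y - u) by rewrite addrA.
have addE z : (\int[m]_u ((divided_tpow k.+1 (y - u))%:E + h%:E * (divided_tpow k (z - u))%:E)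
    = (primitive k.+1 y + h * primitive k z)%:E)%E.
  rewrite ge0_integralD//; last 4 first.
  - by move=> u _; exact: kernel_ge0.
  - exact: measurable_kernel.
  - by move=> u _; rewrite mule_ge0// lee_fin// divided_tpow_ge0.
  - by apply: measurable_funeM; exact: measurable_kernel.
  rewrite ge0_integralZl ?lee_fin ?primitiveE//; first exact: measurable_kernel.
  by move=> u _; exact: kernel_ge0.
rewrite lerBrDl lerBlDl -2!lee_fin -2!addE -primitiveE.
apply/andP; split; apply: ge0_le_integral => //.
- by move=> u _; rewrite adde_ge0 ?mule_ge0 ?lee_fin ?divided_tpow_ge0.
- by apply: emeasurable_funD; [|apply: measurable_funeM]; exact: measurable_kernel.
- exact: measurable_kernel.
- move=> u _; rewrite -EFinM -EFinD lee_fin hu.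
  by case/andP: (divided_tpow_increment k (y - u) h0).
- by move=> u _; exact: kernel_ge0.
- exact: measurable_kernel.
- by apply: emeasurable_funD; [|apply: measurable_funeM]; exact: measurable_kernel.
- move=> u _; rewrite -EFinM -EFinD lee_fin hu.
  by case/andP: (divided_tpow_increment k (y - u) h0).
Qed.

Lemma primitive_nondecreasing k x y : x <= y -> primitive k x <= primitive k y.
Proof.
move=> xy; case: k => [|k].
  rewrite -lee_fin -2!primitive0E; apply: le_measure; rewrite ?inE//.
  by apply: subset_itvl; rewrite bnd_simp.
have yx : 0 <= y - x by rewrite subr_ge0.
have /andP[+ _] := primitive_increments k x yx.
by rewrite subrK => lo; rewrite -subr_ge0; exact: le_trans (mulr_ge0 yx (primitive_ge0 k x)) lo.
Qed.

(** The increments of [primitive k.+1] near [y] are at most [`|h|] times a bound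
    of the nondecreasing function [primitive k]. *)
Lemma primitiveS_continuous k y : primitive k.+1 (h + y) @[h --> 0] --> primitive k.+1 y.
Proof.
pose M := primitive k (1 + y) + 1.
have M0 : 0 < M by rewrite ltr_wpDl// primitive_ge0.
apply/cvgrPdist_le => e e0; near=> h.
have h1 : `|h| <= 1 by near: h; apply: (@nbhs0_le R R^o); exact: ltr01.
have he : `|h| <= e / M by near: h; apply: (@nbhs0_le R R^o); exact: divr_gt0.
suff : `|primitive k.+1 y - primitive k.+1 (h + y)| <= `|h| * M.
  by move=> /le_trans; apply; rewrite -ler_pdivlMr.
have bnd x d : 0 <= d -> d + x <= 1 + y ->
    `|primitive k.+1 x - primitive k.+1 (d + x)| <= d * M.
  move=> d0 dx; have /andP[lo hi] := primitive_increments k x d0.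
  rewrite distrC ger0_norm; last exact: le_trans (mulr_ge0 d0 (primitive_ge0 k x)) lo.
  apply: (le_trans hi); apply: ler_wpM2l => //.
  by apply: (le_trans (primitive_nondecreasing k dx)); rewrite lerDl.
have [h0|h0] := leP 0 h.
  rewrite (ger0_norm h0); apply: bnd => //.
  by rewrite lerD2r (le_trans (ler_norm _) h1).
rewrite (ltr0_norm h0).
have Nh0 : 0 <= - h by rewrite oppr_ge0 ltW.
have hy : - h + (h + y) <= 1 + y by rewrite addKr lerDr.
by have := bnd (h + y) (- h) Nh0 hy; rewrite addKr distrC.
Unshelve. all: by end_near. Qed.

(** Continuity from below of the measure. *)
Lemma primitive0_left_continuous y : primitive 0 (h + y) @[h --> 0^'-] --> primitive 0 y.
Proof.
pose F n := `]-oo, (y - n.+1%:R^-1)%R[%classic : set (measurableTypeR R).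
have UF : \bigcup_n F n = `]-oo, y[%classic.
  apply/seteqP; split => [x [n _]|x]; rewrite /F/= !in_itv/=.
    by move=> /lt_trans; apply; rewrite gtrBl invr_gt0.
  move=> xy; exists (Num.truncn (y - x)^-1) => //=; rewrite in_itv/=.
  rewrite ltrBrDl -ltrBrDr -[ltRHS]invrK ltf_pV2 ?posrE ?invr_gt0 ?subr_gt0//.
  exact: truncnS_gt.
have FE n : m (F n) = (primitive 0 (y - n.+1%:R^-1))%:E by rewrite primitive0E.
have : (m \o F) n @[n --> \oo] --> m (\bigcup_n F n).
  apply: nondecreasing_cvg_mu => //.
  - by move=> n; exact: measurable_itv.
  - by apply: bigcup_measurable => n _; exact: measurable_itv.
  - apply/nondecreasing_seqP => n; apply/subsetPset; apply: subset_itvl.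
    by rewrite bnd_simp lerD2l lerN2 lef_pV2 ?posrE// ler_nat.
rewrite UF primitive0E; under eq_fun do rewrite /= FE.
move=> /fine_cvgP[_] /cvgrPdist_lt cF; apply/cvgrPdist_le => e e0.
have [N _ /(_ N (leqnn N))/= HN] := cF e e0.
near=> h.
have hN : - N.+1%:R^-1 <= h.
  by near: h; apply: nbhs_left_ge; rewrite oppr_lt0 invr_gt0.
have h0 : h <= 0 by near: h; exact: nbhs_left_le.
have hy : h + y <= y by rewrite gerDr.
have Ny : y - N.+1%:R^-1 <= y by rewrite gerBl invr_ge0.
have Nh : y - N.+1%:R^-1 <= h + y by rewrite addrC lerD2r.
have d0 : 0 <= primitive 0 y - primitive 0 (h + y).
  by rewrite subr_ge0; exact: primitive_nondecreasing.
rewrite (ger0_norm d0); apply: le_trans (ltW HN); apply: le_trans (ler_norm _).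
by rewrite lerD2l lerN2; exact: primitive_nondecreasing.
Unshelve. all: by end_near. Qed.

Section scaled.
Variables (c : R) (n : nat).
Hypothesis c0 : 0 <= c.
Let G y : R := c * primitive n y.

Let scaled_increments k :
  increments_between (fun y => c * primitive k.+1 y) (fun y => c * primitive k y).
Proof. by apply: increments_betweenZ => //; exact: primitive_increments. Qed.

Let scaled_left_continuous k y :
  c * primitive k (h + y) @[h --> 0^'-] --> c * primitive k y.
Proof.
apply: cvgM; first exact: cvg_cst.
case: k => [|k]; first exact: primitive0_left_continuous.
by apply: cvg_at_left_filter; exact: primitiveS_continuous.
Qed.

Lemma iter_left_derive_primitive k : (k <= n)%N ->
  iter k left_derive G = (fun y => c * primitive (n - k) y).
Proof.
elim: k => [|k IH] kn; first by rewrite subn0.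
rewrite iterS IH ?(ltnW kn)//; apply/funext => y.
rewrite -(subnSK kn).
apply: (@left_derive_increments _ _ (fun y => c * primitive (n - k.+1) y)).
  exact: scaled_increments.
exact: scaled_left_continuous.
Qed.

Lemma left_derivable_primitive k y : (k < n)%N -> left_derivable (iter k left_derive G) y.
Proof.
move=> kn; rewrite iter_left_derive_primitive ?(ltnW kn)// -(subnSK kn).
apply: (@left_derivable_increments _ _ (fun y => c * primitive (n - k.+1) y)).
  exact: scaled_increments.
exact: scaled_left_continuous.
Qed.

Let scaled_is_derive k y : primitive k (h + y) @[h --> 0] --> primitive k y ->
  is_derive y 1 (fun y => c * primitive k.+1 y) (c * primitive k y).
Proof.
move=> cy; apply: (is_derive_increments (g := fun y => c * primitive k y)).
  exact: scaled_increments.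
by apply: cvgM => //; exact: cvg_cst.
Qed.

(** The case [k = n] is excluded: [primitive 1] need not be differentiable where
    the distribution function jumps. *)
Lemma derive1n_primitive k : (k < n)%N ->
  derive1n k G = (fun y => c * primitive (n - k) y).
Proof.
elim: k => [|k IH] kn; first by rewrite subn0 derive1n0.
rewrite derive1nS IH ?(ltnW kn)//; apply/funext => y.
rewrite -(subnSK (ltnW kn)) derive1E.
have [j ->] : exists j, (n - k.+1)%N = j.+1 by exists (n - k.+2)%N; rewrite subnSK.
by have [_ ->] := scaled_is_derive (@primitiveS_continuous j y).
Qed.

Lemma derivable_primitive k y : (k.+1 < n)%N -> derivable (derive1n k G) y 1.
Proof.
move=> kn; rewrite derive1n_primitive ?(ltnW kn)// -(subnSK (ltnW kn)).
have [j ->] : exists j, (n - k.+1)%N = j.+1 by exists (n - k.+2)%N; rewrite subnSK.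
by have [] := scaled_is_derive (@primitiveS_continuous j y).
Qed.

Lemma derivable_primitive_at k y : primitive 0 (h + y) @[h --> 0] --> primitive 0 y ->
  (k < n)%N -> derivable (derive1n k G) y 1.
Proof.
move=> cy kn; rewrite derive1n_primitive// -(subnSK kn).
have cj j : primitive j (h + y) @[h --> 0] --> primitive j y.
  by case: j => // j; exact: primitiveS_continuous.
by have [] := scaled_is_derive (cj (n - k.+1)%N).
Qed.

Lemma derive1n_primitive_at y : primitive 0 (h + y) @[h --> 0] --> primitive 0 y ->
  derive1n n G y = c * primitive 0 y.
Proof.
move=> cy; have [n0|n0] := posnP n; first by rewrite /G n0 derive1n0.
have pn : (n.-1 < n)%N by rewrite ltn_predL.
rewrite -[X in derive1n X](prednK n0) derive1nS derive1n_primitive//.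
rewrite -(subnSK pn) (prednK n0) subnn derive1E.
by have [_ ->] := scaled_is_derive cy.
Qed.

End scaled.
End primitive.

(** * From [0, +oo] to the real line *)

Section finite_part.
Context {R : realType}.
Implicit Types (s y alpha : R) (mu : {measure set (\bar R) -> \bar R}).

Definition finite_half_line : set (\bar R) := [set t | (0 <= t < +oo)%E].

Lemma measurable_finite_half_line : measurable finite_half_line.
Proof.
rewrite (_ : finite_half_line = `[0%E, +oo%E[%classic); first exact: emeasurable_itv.
by apply/seteqP; split => x /=; rewrite in_itv.
Qed.

(** The part of a measure on [0, +oo] carried by the finite points, as a
    measure on the real line. *)
Definition finite_part mu : {measure set (measurableTypeR R) -> \bar R} :=
  image_measure (mrestr mu measurable_finite_half_line)
    (fine_measurable measurableT : measurable_fun setT (fine : \bar R -> measurableTypeR R)).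

Lemma finite_partE mu A : finite_part mu A = mu (fine @^-1` A `&` finite_half_line).
Proof. by []. Qed.

Lemma integral_finite_part mu (f : R -> \bar R) :
  measurable_fun setT f -> (forall x, 0 <= f x)%E ->
  (\int[finite_part mu]_x f x = \int[mu]_(t in finite_half_line) f (fine t))%E.
Proof.
move=> mf f0; rewrite /finite_part ge0_integral_image//.
have N0 : mrestr mu measurable_finite_half_line (~` finite_half_line) = 0%E.
  by rewrite /mrestr setICl measure0.
rewrite (ge0_negligible_integral _ _ _ _ N0)//; last 2 first.
- exact/measurableC/measurable_finite_half_line.
- exact: measurableT_comp mf (fine_measurable measurableT).
rewrite setTD setCK; apply: eq_measure_integral => //= A mA AP.
by rewrite /mrestr; congr (mu _); exact/setIidl.
Qed.

Lemma finite_part_lt0 mu : finite_part mu `]-oo, 0%R[%classic = 0%E.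
Proof.
rewrite finite_partE [X in mu X](_ : _ = set0) ?measure0//.
apply/seteqP; split => // -[r| |]; rewrite /finite_half_line/= in_itv/= ?ltxx; case => //.
by rewrite lee_fin => r0 /andP[]; rewrite leNgt r0.
Qed.

Let measurable_tpow_shift a y : measurable_fun setT (fun u : R => (tpow a (y - u))%:E).
Proof.
apply/measurable_EFinP; apply: measurableT_comp; last exact: measurable_funB.
exact: measurable_tpow.
Qed.

Lemma RL_integralE mu s y :
  RL_integral s mu y = frac_density (1 - s) (finite_part mu) y.
Proof.
rewrite /frac_density integral_finite_part//; last first.
  by move=> u; rewrite lee_fin tpow_ge0.
rewrite /RL_integral [LHS]integral_mkcond [RHS]integral_mkcond.
apply: eq_integral => -[u| |] _; rewrite !patchE.
- have [u0|u0] := leP 0 u; last first.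
    by rewrite !memNset//= /finite_half_line/= lee_fin leNgt u0.
  rewrite [in RHS]mem_set/=; last by rewrite /finite_half_line/= lee_fin u0 ltry.
  have [uy|yu] := ltP u y.
    rewrite mem_set/= ?lee_fin ?lte_fin ?u0//.
    by rewrite /tpow subr_gt0 uy addrAC subrr sub0r powRN.
  rewrite memNset/= ?tpow_le0 ?subr_le0//.
  by rewrite lee_fin lte_fin u0/= => /lt_geF; rewrite yu.
- by rewrite !memNset//= /finite_half_line/= ?ltxx ?andbF// ltNge leey andbF.
- by rewrite !memNset//= /finite_half_line/=.
Qed.

Lemma distr_funE mu y : distr_fun mu y = finite_part mu `]-oo, y[%classic.
Proof.
rewrite finite_partE /distr_fun; congr (mu _).
apply/seteqP; split => -[u| |] //=; rewrite /finite_half_line/= in_itv/=.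
- by rewrite lte_fin ltry andbT => /andP[].
- by rewrite ltNge !leey.
- by rewrite lte_fin => -[-> /andP[->]].
- by rewrite ltxx andbF => -[].
- by case.
Qed.

Lemma Mclass_weight alpha mu : in_Mclass alpha mu ->
  (\int[finite_part mu]_x ((1 + x) `^ (- alpha))%:E < +oo)%E.
Proof.
move=> [_ + _]; rewrite integral_finite_part//; last first.
- by move=> x; rewrite lee_fin powR_ge0.
- apply/measurable_EFinP; apply: (measurableT_comp (measurable_powR _)).
  exact: measurable_funD.
Qed.

Lemma Mclass_finite_below alpha mu : 0 < alpha -> in_Mclass alpha mu ->
  finite_below (finite_part mu).
Proof.
move=> al0 /Mclass_weight fin y.
exact: (measure_lty_of_weight (finite_part_lt0 mu) y al0 fin).
Qed.

Lemma finite_below_sigma_finite (m : set (measurableTypeR R) -> \bar R) :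
  finite_below m -> sigma_finite setT m.
Proof.
move=> fin; exists (fun n => `]-oo, n%:R[%classic) => [|n].
  apply/seteqP; split => // x _; exists (Num.truncn `|x|).+1 => //=.
  by rewrite in_itv/= (le_lt_trans (ler_norm x))// truncnS_gt.
by split; [exact: measurable_itv|exact: fin].
Qed.

End finite_part.

Section finite_below_measure.
Context {R : realType}.
Variable m : {measure set (measurableTypeR R) -> \bar R}.

(** A copy of [m] that carries a proof, from which the sigma-finite structure
    required by Tonelli's theorem is inferred. *)
Definition finite_below_measure (fin_m : finite_below m) :
  set (measurableTypeR R) -> \bar R := m.

Hypothesis fin_m : finite_below m.

HB.instance Definition _ := Measure.on (finite_below_measure fin_m).
HB.instance Definition _ := @Measure_isSigmaFinite.Build _ _ _ (finite_below_measure fin_m)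
  (finite_below_sigma_finite fin_m).

End finite_below_measure.

(** * The fractional integral as a measure on [0, +oo] *)

Section fractional_integral_measure.
Context {R : realType}.
Variables (alpha eta : R) (mu : {measure set (\bar R) -> \bar R}).
Hypotheses (alpha_gt0 : 0 < alpha) (eta_gt0 : 0 < eta) (Mmu : in_Mclass alpha mu).
Local Notation leb := (@lebesgue_measure R).
Local Notation m := (finite_part mu).

Local Lemma fin_m : finite_below m.
Proof. exact: Mclass_finite_below Mmu. Qed.

Local Notation sm := (finite_below_measure fin_m).

Local Lemma igamma_ge0 : 0 <= (gamma_fun eta)^-1.
Proof. by rewrite invr_ge0 ltW// gamma_fun_gt0. Qed.

Definition RL_density y : \bar R := ((gamma_fun eta)^-1%:E * frac_density eta m y)%E.

Local Lemma measurable_fd : measurable_fun [set: R] (frac_density eta m).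
Proof. exact: (measurable_frac_density eta sm). Qed.

Local Lemma measurable_RL_density : measurable_fun [set: measurableTypeR R] RL_density.
Proof. by apply: measurable_funeM; exact: measurable_fd. Qed.

Local Lemma RL_density_ge0 y : (0 <= RL_density y)%E.
Proof. by rewrite mule_ge0 ?lee_fin ?igamma_ge0// frac_density_ge0. Qed.

Local Lemma RL_density_le0 y : y <= 0 -> RL_density y = 0%E.
Proof. by move=> y0; rewrite /RL_density frac_density_le0 ?mule0// finite_part_lt0. Qed.

Local Lemma measurable_EFinR : measurable_fun [set: measurableTypeR R] (@EFin R).
Proof. exact: EFin_measurable. Qed.

Definition frac_measure : {measure set (\bar R) -> \bar R} :=
  measure_add
    (image_measure (density_measure leb measurable_RL_density RL_density_ge0) measurable_EFinR)
    (mrestr mu (emeasurable_set1 +oo%E)).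

Lemma frac_measure_densityE B : frac_measure B =
  (\int[leb]_(y in EFin @^-1` B) RL_density y + mu (B `&` [set +oo]))%E.
Proof. exact: measure_addE. Qed.

Local Lemma integral_RL_density_ge0 (A : set R) :
  (\int[leb]_(y in A) RL_density y = \int[leb]_(y in [set y : R | (0 <= y)%R /\ A y]) RL_density y)%E.
Proof.
rewrite [LHS]integral_mkcond [RHS]integral_mkcond; apply: eq_integral => y _.
rewrite !patchE; have [y0|y0] := leP 0 y; last by rewrite RL_density_le0 ?(ltW y0)// !if_same.
congr (if _ then _ else _); apply/idP/idP; rewrite !inE/=; first by [].
by case.
Qed.

Lemma frac_measureE B : measurable B -> frac_measure B = frac_integral eta mu B.
Proof.
move=> mB; rewrite frac_measure_densityE /frac_integral; congr (_ + _)%E.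
have mA : measurable [set y : R | 0 <= y /\ B y%:E].
  have -> : [set y : R | 0 <= y /\ B y%:E] = `[0%R, +oo[ `&` EFin @^-1` B.
    by apply/seteqP; split => y/=; rewrite in_itv/= andbT.
  apply: measurableI => //; rewrite -[X in measurable X]setTI.
  exact: EFin_measurable.
rewrite integral_RL_density_ge0 /RL_density ge0_integralZl//; last 3 first.
- by apply: measurable_funTS; exact: measurable_fd.
- by move=> y _; exact: frac_density_ge0.
- by rewrite lee_fin igamma_ge0.
congr (_ * _)%E; apply: eq_integral => y _.
by rewrite RL_integralE opprB addrC subrK.
Qed.

Lemma integral_frac_measure (f : R -> \bar R) :
  measurable_fun setT f -> (forall x, 0 <= f x)%E ->
  (\int[finite_part frac_measure]_x f x = \int[leb]_x (f x * RL_density x))%E.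
Proof.
move=> mf f0.
rewrite -(ge0_integral_density leb measurable_RL_density RL_density_ge0)//.
apply: eq_measure_integral => A mA _.
rewrite finite_partE frac_measure_densityE [X in (_ + mu X)%E](_ : _ = set0); last first.
  apply/seteqP; split => // t [[_]]; rewrite /finite_half_line/= => /[swap] ->.
  by rewrite ltxx andbF.
rewrite measure0 adde0 [RHS]integral_RL_density_ge0; congr (integral _ _ _).
apply/seteqP; split => y; rewrite /finite_half_line/= lee_fin ltry andbT.
  by case.
by case.
Qed.

Lemma frac_measure_Mclass : in_Mclass (alpha + eta) frac_measure.
Proof.
have mw : measurable_fun setT (fun x : R => ((1 + x) `^ (- (alpha + eta)))%:E).
  apply/measurable_EFinP; apply: (measurableT_comp (measurable_powR _)).
  exact: measurable_funD.
have w0 (x : R) : (0 <= ((1 + x) `^ (- (alpha + eta)))%:E)%E by rewrite lee_fin powR_ge0.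
split.
- rewrite frac_measure_densityE integral0_eq; last first.
    by move=> y /=; rewrite lte_fin => y0; rewrite RL_density_le0// ltW.
  rewrite add0e [X in mu X](_ : _ = set0) ?measure0//.
  by apply/seteqP; split => // t /= [+ t1]; rewrite t1 ltNge leey.
- rewrite -(integral_finite_part frac_measure mw w0) integral_frac_measure//.
  under eq_integral do rewrite /RL_density muleCA.
  rewrite ge0_integralZl//; last 3 first.
  + by apply: emeasurable_funM => //; exact: measurable_fd.
  + by move=> x _; rewrite mule_ge0// frac_density_ge0.
  + by rewrite lee_fin igamma_ge0.
  apply: lte_mul_pinfty => //; first by rewrite lee_fin igamma_ge0.
  apply: (integral_weight_frac_density (m := sm) alpha_gt0 eta_gt0).
    exact: finite_part_lt0.
  exact: Mclass_weight Mmu.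
- rewrite frac_measure_densityE (_ : EFin @^-1` _ = set0); last by apply/seteqP; split.
  by rewrite integral_set0 add0e setIid; case: Mmu.
Qed.

Lemma frac_measure_atom : frac_measure [set +oo%E] = mu [set +oo%E].
Proof.
rewrite frac_measure_densityE (_ : EFin @^-1` _ = set0); last by apply/seteqP; split.
by rewrite integral_set0 add0e setIid.
Qed.

(** Fractional integration of order [1 + n - eta], after the one of order [eta],
    has the integral order [n + 1]. The bound on [eta] makes the order
    [1 + n - eta] positive. *)
Lemma RL_integral_frac_measure (n : nat) y : eta < n.+1%:R ->
  RL_integral (eta - n%:R) frac_measure y =
  (gamma_fun (1 + n%:R - eta) * primitive m n y)%:E.
Proof.
move=> etan; set b := 1 + n%:R - eta.
have b0 : 0 < b by rewrite subr_gt0 nat1r.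
have mt c : measurable_fun setT (fun v : R => (tpow c (y - v))%:E).
  apply/measurable_EFinP; apply: measurableT_comp; last exact: measurable_funB.
  exact: measurable_tpow.
have t0 c v : (0 <= (tpow c (y - v))%:E)%E by rewrite lee_fin tpow_ge0.
rewrite RL_integralE (_ : 1 - (eta - n%:R) = b); last by rewrite /b; ring.
rewrite /frac_density integral_frac_measure//.
under eq_integral do rewrite /RL_density muleCA.
rewrite ge0_integralZl//; last 3 first.
- by apply: emeasurable_funM; [exact: mt|exact: measurable_fd].
- by move=> x _; rewrite mule_ge0 ?t0// frac_density_ge0.
- by rewrite lee_fin igamma_ge0.
rewrite (frac_density_conv eta b y sm).
have etab : eta + b = n.+1%:R by rewrite /b -nat1r; ring.
have -> : frac_density (eta + b) sm y = (n`!%:R%:E * (primitive m n y)%:E)%E.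
  rewrite -primitiveE; last 2 first.
  - exact: finite_part_lt0.
  - exact: fin_m.
  rewrite etab -ge0_integralZl//.
  - by apply: eq_integral => u _; rewrite /divided_tpow -EFinM mulrC divfK.
  - apply/measurable_EFinP; apply: measurableT_comp; last exact: measurable_funB.
    exact: measurable_divided_tpow.
  - by move=> u _; rewrite lee_fin divided_tpow_ge0.
rewrite [in X in (_ * X)%E]muleA -eGamma_natS -etab -eGammaM !eGamma_fun//.
rewrite -!EFinM; congr EFin; by rewrite -mulrA mulKf// gt_eqF// gamma_fun_gt0.
Qed.

End fractional_integral_measure.

Theorem theoremA1 (R : realType) (alpha eta : R)
    (mu : {measure set (\bar R) -> \bar R}) :
  0 < alpha -> 0 < eta -> in_Mclass alpha mu ->
  exists nu : {measure set (\bar R) -> \bar R},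
    [/\ forall B : set (\bar R), measurable B -> nu B = frac_integral eta mu B,
        in_Mclass (alpha + eta) nu,
        let n := Num.truncn eta in
        let c := (gamma_fun (1 + n%:R - eta))^-1 in
        let G := fun y : R => fine (RL_integral (eta - n%:R) nu y) in
        [/\ forall y : R, (RL_integral (eta - n%:R) nu y < +oo)%E,
            (* the n-fold left derivative gives F_mu at every point *)
            (forall (k : nat) (y : R), (k < n)%N ->
               left_derivable (iter k left_derive G) y) /\
            (forall y : R, 0 <= y ->
               distr_fun mu y = (c * iter n left_derive G y)%:E)
          & (* the ordinary n-th derivative gives F_mu at its continuity points *)
            (forall (k : nat) (y : R), (k.+1 < n)%N -> derivable (derive1n k G) y 1) /\
            (forall y : R, 0 <= y -> {for y, continuous (distr_fun mu)} ->
               (forall k : nat, (k < n)%N -> derivable (derive1n k G) y 1) /\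
               distr_fun mu y = (c * derive1n n G y)%:E)]
      & mu [set +oo%E] = nu [set +oo%E]].
Proof.
move=> alpha0 eta0 Mmu.
exists (frac_measure alpha0 eta0 Mmu); split.
- exact: frac_measureE.
- exact: frac_measure_Mclass.
- move=> n c G.
  have supp := finite_part_lt0 mu.
  have fin := Mclass_finite_below alpha0 Mmu.
  have etan : eta < n.+1%:R by exact: truncnS_gt.
  pose g := gamma_fun (1 + n%:R - eta).
  have g0 : 0 < g by apply: gamma_fun_gt0; rewrite subr_gt0 nat1r.
  have RLE y : RL_integral (eta - n%:R) (frac_measure alpha0 eta0 Mmu) y =
      (g * primitive (finite_part mu) n y)%:E by exact: RL_integral_frac_measure.
  have GE : G = (fun y => g * primitive (finite_part mu) n y).
    by apply/funext => y; rewrite /G RLE.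
  have FE y : distr_fun mu y = (primitive (finite_part mu) 0 y)%:E.
    by rewrite distr_funE primitive0E.
  split.
  + by move=> y; rewrite RLE ltry.
  + rewrite GE; split=> [k y kn|y _].
      by apply: left_derivable_primitive => //; exact: ltW.
    rewrite FE iter_left_derive_primitive ?(ltW g0)// subnn.
    by rewrite /c -/g mulKf// gt_eqF.
  + rewrite GE; split=> [k y kn|y _ cF].
      by apply: derivable_primitive => //; exact: ltW.
    have cy : primitive (finite_part mu) 0 (h + y) @[h --> 0] -->
        primitive (finite_part mu) 0 y.
      have /fine_cvg : (primitive (finite_part mu) 0 z)%:E @[z --> y] -->
          (primitive (finite_part mu) 0 y)%:E.
        by rewrite -FE; under eq_fun do rewrite -FE; exact: cF.
      move=> cz; apply: (cvg_comp _ _ _ cz).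
      have : h + y @[h --> (0 : R)] --> 0 + y.
        by apply: cvgD; [exact: cvg_id|exact: cvg_cst].
      by rewrite add0r.
    split=> [k kn|]; first by apply: derivable_primitive_at => //; exact: ltW.
    by rewrite FE derive1n_primitive_at ?(ltW g0)// /c -/g mulKf// gt_eqF.
- exact/esym/frac_measure_atom.
Qed.
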